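(* Let $\mathbf{a}=(a_1,a_2)$ and $\mathbf{b}=(b_1,b_2)$ be linearly independent vectors in $\mathbb{R}^2$, let $c_1<d_1$, $c_2<d_2$, and let $$\Omega=\{\mathbf{x}\in\mathbb{R}^2:\ c_1\le\mathbf{a}\cdot\mathbf{x}\le d_1,\ c_2\le\mathbf{b}\cdot\mathbf{x}\le d_2\}.$$ Let $f\in C(\Omega)$ have continuous partial derivatives $\frac{\partial^2f}{\partial x_1^2},\frac{\partial^2f}{\partial x_1\partial x_2},\frac{\partial^2f}{\partial x_2^2}$ on $\Omega$, and suppose that for every $\mathbf{x}\in\Omega$ $$\frac{\partial^2f}{\partial x_1\partial x_2}(a_1b_2+a_2b_1)-\frac{\partial^2f}{\partial x_1^2}a_2b_2-\frac{\partial^2f}{\partial x_2^2}a_1b_1\ge0.$$ Then $$E(f,\mathcal{R})=\tfrac14\big(f_1(c_1,c_2)+f_1(d_1,d_2)-f_1(c_1,d_2)-f_1(d_1,c_2)\big),$$ where $$f_1(y_1,y_2)=f\left(\frac{y_1b_2-y_2a_2}{a_1b_2-a_2b_1},\frac{y_2a_1-y_1b_1}{a_1b_2-a_2b_1}\right).$$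
   Context: $\mathcal{R}=\mathcal{R}(\mathbf{a},\mathbf{b})=\{g_1(\mathbf{a}\cdot\mathbf{x})+g_2(\mathbf{b}\cdot\mathbf{x}):g_1,g_2\in C(\mathbb{R})\}$ and $E(f,\mathcal{R})=\inf_{g\in\mathcal{R}}\max_{\mathbf{x}\in\Omega}|f(\mathbf{x})-g(\mathbf{x})|$ is the error of uniform approximation. *)

(* Defs.v *)
From HB Require Import structures.
From mathcomp Require Import all_boot all_order all_algebra.
From mathcomp Require Import all_classical all_reals all_analysis.

Set Implicit Arguments.
Unset Strict Implicit.
Unset Printing Implicit Defensive.

Import Order.TTheory GRing.Theory Num.Theory.
Import numFieldNormedType.Exports.

Local Open Scope classical_set_scope.
Local Open Scope ring_scope.

(* A vector x of R^2 is a row vector; its coordinates x_1, x_2 are x 0 0 and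
   x 0 1. *)

Definition dot (R : realType) (u v : 'rV[R]_2) : R :=
  \sum_(i < 2) u 0 i * v 0 i.

Definition vec2 (R : realType) (s t : R) : 'rV[R]_2 :=
  \row_(i < 2) (if i == 0 then s else t).

Definition parallelogram (R : realType) (a b : 'rV[R]_2) (c1 d1 c2 d2 : R) :
    set 'rV[R]_2 :=
  [set x | c1 <= dot a x <= d1 /\ c2 <= dot b x <= d2].

(* Sums of two ridge functions with fixed directions a and b. *)
Definition ridge_sums (R : realType) (a b : 'rV[R]_2) : set ('rV[R]_2 -> R) :=
  [set g | exists g1 g2 : R -> R, [/\ continuous g1, continuous g2 &
             g = (fun x => g1 (dot a x) + g2 (dot b x))]].

(* The values are extended reals, so that no default value is used for an
   infinite supremum or infimum. When f and g are continuous on a nonempty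
   compact set Om, the inner supremum is the maximum of |f - g| over Om. *)
Definition approx_error (R : realType) (Om : set 'rV[R]_2) (f : 'rV[R]_2 -> R)
    (G : set ('rV[R]_2 -> R)) : \bar R :=
  ereal_inf [set ereal_sup [set (`|f x - g x|)%:E | x in Om] | g in G].

(* fij is the continuous partial derivative d/dx_i (d f/dx_j) on Om. The
   derivatives are taken at interior points; since a coordinate line through a
   boundary point may meet Om at that point only, the value of the derivative
   at a boundary point is that of the continuous extension from the interior
   (unique when Om is the closure of its interior). *)
Definition continuous_partial2 (R : realType) (Om : set 'rV[R]_2)
    (f : 'rV[R]_2 -> R) (i j : 'I_2) (fij : 'rV[R]_2 -> R) : Prop :=
  {within Om, continuous fij} /\
  forall x, Om° x ->
    derivable f x (delta_mx 0 j) /\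
    is_derive x (delta_mx 0 i) (fun y => 'D_(delta_mx 0 j) f y) (fij x).

(* f in the coordinates y_1 = a.x, y_2 = b.x. *)
Definition f_coord (R : realType) (a b : 'rV[R]_2) (f : 'rV[R]_2 -> R)
    (y1 y2 : R) : R :=
  let D := a 0 0 * b 0 1 - a 0 1 * b 0 0 in
  f (vec2 ((y1 * b 0 1 - y2 * a 0 1) / D) ((y2 * a 0 0 - y1 * b 0 0) / D)).

(* Main.v *)
Require Import Defs.
From HB Require Import structures.
From mathcomp Require Import all_boot all_order all_algebra.
From mathcomp Require Import all_classical all_reals all_analysis.
From mathcomp Require Import ring lra.

(* In the coordinates y1 = a.x, y2 = b.x the parallelogram is a rectangle and
   the differential inequality says that the mixed derivative of f in y is
   nonnegative. Hence the alternating corner sum of f over every subrectangle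
   is nonnegative: otherwise bisection would yield shrinking rectangles
   on which it stays below a fixed negative multiple of the area, against the
   second-order expansion of f at the limit point. At the corners of the big
   rectangle, sums of ridge functions have alternating sum 0, so the alternating
   sum L of f is at most 4 |f - g|. Conversely a point y cuts the rectangle into
   four pieces with corner sums A, B, C, D >= 0 and A + B + C + D = L; averaging
   f over opposite sides gives a g with f - g = (A - B - C + D) / 4. *)

Set Implicit Arguments.
Unset Strict Implicit.
Unset Printing Implicit Defensive.

Import Order.TTheory GRing.Theory Num.Theory.
Import numFieldNormedType.Exports.

Local Open Scope classical_set_scope.
Local Open Scope ring_scope.

(** * Mean value and Taylor estimates *)

(** Locating [z] only by its distance to [u] covers increments of either sign, so later estimates
    need no case split on the sign. *)
Lemma mean_value_ball (R : realType) (g g' : R -> R) (u x : R) :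
  (forall z, `|z - u| <= `|x - u| -> is_derive z 1 g (g' z)) ->
  exists2 z, `|z - u| <= `|x - u| & g x - g u = g' z * (x - u).
Proof.
move=> dg.
have key y z : (forall t, t \in `[y, z] -> `|t - u| <= `|x - u|) -> y <= z ->
    exists2 t, `|t - u| <= `|x - u| & g z - g y = g' t * (z - y).
  move=> sub yz.
  have [t tyz ->] : exists2 t, t \in `[y, z]%R & g z - g y = g' t * (z - y).
    apply: MVT_segment => // [t /subset_itv_oo_cc/sub/dg//|].
    apply: derivable_within_continuous => t /sub/dg []//.
  by exists t => //; exact: sub.
have [ux|xu] := leP u x.
  apply: key => // t; rewrite in_itv/= => /andP[ut tx].
  by rewrite !ger0_norm ?subr_ge0// ?lerD2r//; exact: le_trans tx.
have [t] : exists2 t, `|t - u| <= `|x - u| & g u - g x = g' t * (u - x).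
  apply: key => //; last exact: ltW.
  move=> t; rewrite in_itv/= => /andP[xt tu].
  by rewrite !ler0_norm ?subr_le0// ?lerN2 ?lerD2r// ltW.
by move=> tu E; exists t => //; rewrite -opprB E -mulrN opprB.
Qed.

(** Two applications of the mean value theorem to [g] minus its quadratic model give the remainder
    [(g'' t - q) * (z - u) * h], with [z] and [t] within [|h|] of [u]. The crude constant [e]
    instead of [e / 2] suffices. *)
Lemma taylor_second_order (R : realType) (g g' g'' : R -> R) (u h q e : R) :
  (forall z, `|z - u| <= `|h| ->
    [/\ is_derive z 1 g (g' z), is_derive z 1 g' (g'' z) & `|g'' z - q| <= e]) ->
  `|g (u + h) - g u - g' u * h - q / 2 * h ^+ 2| <= e * h ^+ 2.
Proof.
move=> H.
pose r x := g x - g' u * x - q / 2 * (x - u) ^+ 2.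
pose r' x := g' x - g' u - q * (x - u).
have huh : `|u + h - u| = `|h| by rewrite addrC addKr.
have [z zh rE] : exists2 z, `|z - u| <= `|u + h - u| &
    r (u + h) - r u = r' z * (u + h - u).
  apply: mean_value_ball => z; rewrite huh => /H [dg _ _].
  rewrite /r /r'.
  have -> : (fun x => g x - g' u * x - q / 2 * (x - u) ^+ 2) =
      g - (g' u \*o id) - ((q / 2) \*o ((id - cst u) ^+ 2)) by apply: funext.
  apply: is_derive_eq; by rewrite /GRing.scale/= !fctE; field.
rewrite huh in zh.
have [t tz gE] : exists2 t, `|t - u| <= `|z - u| & g' z - g' u = g'' t * (z - u).
  by apply: mean_value_ball => t tz; have [] := H t (le_trans tz zh).
have -> : g (u + h) - g u - g' u * h - q / 2 * h ^+ 2 = r (u + h) - r u.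
  rewrite /r; ring.
have [_ _ te] := H t (le_trans tz zh).
have -> : r (u + h) - r u = (g'' t - q) * (z - u) * h.
  rewrite rE /r' gE; ring.
have -> : h ^+ 2 = `|h| * `|h| by rewrite -expr2 real_normK ?num_real.
by rewrite !normrM -mulrA !ler_pM// mulr_ge0.
Qed.

(* The increment is split along the second axis first, so that of the two mixed
   derivatives only d/dx (d f/dy) is needed, and no symmetry theorem. *)
Lemma taylor_mixed (R : realType) (f f1 f2 f11 f12 f22 : R -> R -> R)
    (u v q11 q12 q22 h k e : R) :
  (forall x y, `|x - u| <= `|h| -> `|y - v| <= `|k| ->
    [/\ is_derive x 1 (f^~ y) (f1 x y), is_derive y 1 (f x) (f2 x y),
        is_derive x 1 (f1^~ y) (f11 x y), is_derive x 1 (f2^~ y) (f12 x y) &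
        is_derive y 1 (f2 x) (f22 x y)] /\
    [/\ `|f11 x y - q11| <= e, `|f12 x y - q12| <= e & `|f22 x y - q22| <= e]) ->
  `|f (u + h) (v + k) - (f u v + f1 u v * h + f2 u v * k + q11 / 2 * h ^+ 2
     + q12 * h * k + q22 / 2 * k ^+ 2)| <= 2 * e * (h ^+ 2 + k ^+ 2).
Proof.
move=> H.
have huh : `|u + h - u| = `|h| by rewrite addrC addKr.
have A1 : `|f (u + h) (v + k) - f (u + h) v - f2 (u + h) v * k
    - q22 / 2 * k ^+ 2| <= e * k ^+ 2.
  apply: (@taylor_second_order _ _ (f2 (u + h)) (f22 (u + h))) => z zk.
  by have [|[? ? ? ? ?] []] := H (u + h) z _ zk; rewrite ?huh.
have A2 : `|f (u + h) v - f u v - f1 u v * h - q11 / 2 * h ^+ 2| <= e * h ^+ 2.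
  apply: (@taylor_second_order _ (f^~ v) (f1^~ v) (f11^~ v)) => z zh.
  by have [|[? ? ? ? ?] []] := H z v zh; rewrite ?subrr ?normr0.
have [z zh E] : exists2 z, `|z - u| <= `|u + h - u| &
    f2 (u + h) v - f2 u v = f12 z v * (u + h - u).
  apply: mean_value_ball (f2^~ v) (f12^~ v) _ _ _ => z; rewrite huh => zh.
  by have [|[? ? ? ? ?] []] := H z v zh; rewrite ?subrr ?normr0.
rewrite huh in zh.
have A3 : `|(f12 z v - q12) * h * k| <= e * (`|h| * `|k|).
  have [|_ [_ ? _]] := H z v zh; first by rewrite subrr normr0.
  by rewrite !normrM -mulrA ler_pM// mulr_ge0.
have e0 : 0 <= e.
  have [||_ [+ _ _]] := H u v; rewrite ?subrr ?normr0//.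
  exact: le_trans.
have hk : `|h| * `|k| <= h ^+ 2 + k ^+ 2.
  rewrite -(real_normK (num_real h)) -(real_normK (num_real k)).
  by nra.
(* The error has three parts: the vertical step along [u + h], the horizontal step along [v], and
   the change of [f2] from [u] to [u + h], which yields the mixed term. *)
have -> : f (u + h) (v + k) - (f u v + f1 u v * h + f2 u v * k + q11 / 2 * h ^+ 2
     + q12 * h * k + q22 / 2 * k ^+ 2) =
  (f (u + h) (v + k) - f (u + h) v - f2 (u + h) v * k - q22 / 2 * k ^+ 2) +
  (f (u + h) v - f u v - f1 u v * h - q11 / 2 * h ^+ 2) + (f12 z v - q12) * h * k.
  have -> : f2 (u + h) v = f2 u v + f12 z v * h.
    by rewrite -[LHS](subrK (f2 u v)) E [u + h]addrC addrK addrC.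
  ring.
have /le_trans := ler_normD (f (u + h) (v + k) - f (u + h) v - f2 (u + h) v * k
    - q22 / 2 * k ^+ 2 + (f (u + h) v - f u v - f1 u v * h - q11 / 2 * h ^+ 2))
  ((f12 z v - q12) * h * k).
apply; apply: le_trans (lerD (ler_normD _ _) A3) _.
apply: le_trans (lerD (lerD A1 A2) (ler_wpM2l e0 hk)) _.
by rewrite le_eqVlt; apply/orP; left; apply/eqP; ring.
Qed.

(** * Corner sums over rectangles *)

(** This discrete mixed derivative vanishes on functions of one variable, hence on sums of such
    functions. *)
Definition rect_diff (R : realType) (F : R -> R -> R) (s s' t t' : R) : R :=
  F s t + F s' t' - F s t' - F s' t.

(** [A], [B], [C] are hidden because they cancel in corner sums. [P] and [S] cancel too, but stay
    visible because a linear change of variables mixes them into the new [q]. *)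
Definition peano_expansion (R : realType) (F : R -> R -> R) (s t P q S : R) : Prop :=
  exists A B C : R, forall e, 0 < e -> exists2 d, 0 < d &
    forall h k, `|h| < d -> `|k| < d ->
    `|F (s + h) (t + k) - (A + B * h + C * k + P * h ^+ 2 + q * h * k + S * k ^+ 2)|
       <= e * (h ^+ 2 + k ^+ 2).

(** The expansion point may lie anywhere in the rectangle: in the alternating sum only [q * w * v]
    survives, and each corner contributes an error of at most [e * (w ^+ 2 + v ^+ 2)]. *)
Lemma rect_diff_expansion (R : realType) (F : R -> R -> R) (p1 p2 P q S e : R) :
  peano_expansion F p1 p2 P q S -> 0 < e ->
  exists2 d, 0 < d & forall s t w v, s <= p1 <= s + w -> t <= p2 <= t + v ->
    w < d -> v < d ->
    `|rect_diff F s (s + w) t (t + v) - q * w * v| <= 4 * e * (w ^+ 2 + v ^+ 2).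
Proof.
move=> [A [B [C H]]] e0; have [d d0 {}H] := H _ e0.
exists d => // s t w v /andP[s1 s2] /andP[t1 t2] wd vd.
have K s0 t0 : `|s0 - p1| <= w -> `|t0 - p2| <= v ->
    `|F s0 t0 - (A + B * (s0 - p1) + C * (t0 - p2) + P * (s0 - p1) ^+ 2
      + q * (s0 - p1) * (t0 - p2) + S * (t0 - p2) ^+ 2)| <= e * (w ^+ 2 + v ^+ 2).
  move=> sw tv.
  have := H (s0 - p1) (t0 - p2) (le_lt_trans sw wd) (le_lt_trans tv vd).
  rewrite !subrKC => /le_trans; apply; rewrite ler_wpM2l ?(ltW e0)// lerD//.
    by rewrite -(real_normK (num_real (s0 - p1))) lerXn2r ?nnegrE ?(le_trans _ sw).
  by rewrite -(real_normK (num_real (t0 - p2))) lerXn2r ?nnegrE ?(le_trans _ tv).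
have sw : `|s - p1| <= w by rewrite ler_norml; lra.
have sw' : `|s + w - p1| <= w by rewrite ler_norml; lra.
have tv : `|t - p2| <= v by rewrite ler_norml; lra.
have tv' : `|t + v - p2| <= v by rewrite ler_norml; lra.
have := K _ _ sw tv; have := K _ _ sw tv'; have := K _ _ sw' tv; have := K _ _ sw' tv'.
rewrite !ler_norml /rect_diff => /andP[? ?] /andP[? ?] /andP[? ?] /andP[? ?].
lra.
Qed.

Lemma rect_diff_ge0 (R : realType) (F : R -> R -> R) (s0 s1 t0 t1 : R) :
  s0 < s1 -> t0 < t1 ->
  (forall s t, s0 <= s <= s1 -> t0 <= t <= t1 ->
     exists P q S, 0 <= q /\ peano_expansion F s t P q S) ->
  0 <= rect_diff F s0 s1 t0 t1.
Proof.
move=> s01 t01 H; rewrite leNgt; apply/negP => neg.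
pose w n := (s1 - s0) / 2 ^+ n; pose v n := (t1 - t0) / 2 ^+ n.
have w0 n : 0 < w n by rewrite divr_gt0 ?subr_gt0 ?exprn_gt0.
have v0 n : 0 < v n by rewrite divr_gt0 ?subr_gt0 ?exprn_gt0.
have w2 n : w n = 2 * w n.+1 by rewrite /w exprS; field; rewrite expf_neq0.
have v2 n : v n = 2 * v n.+1 by rewrite /v exprS; field; rewrite expf_neq0.
(* [- k] is the corner sum per unit area of the whole rectangle; bisection preserves this bound. *)
pose k := - rect_diff F s0 s1 t0 t1 / (w 0%N * v 0%N).
have k0 : 0 < k by apply: divr_gt0; [rewrite oppr_gt0|exact: mulr_gt0].
pose bad n (c : R * R) :=
  rect_diff F c.1 (c.1 + w n) c.2 (c.2 + v n) <= - k * (w n * v n).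
(* Badness is a premise under the existential so that [choice] gives a total selection function. *)
have step (nc : nat * (R * R)) : exists c' : R * R, bad nc.1 nc.2 ->
  [/\ bad nc.1.+1 c', nc.2.1 <= c'.1 <= nc.2.1 + w nc.1.+1 &
      nc.2.2 <= c'.2 <= nc.2.2 + v nc.1.+1].
  case: nc => n [s t] /=.
  have wn := w0 n.+1; have vn := v0 n.+1.
  case: (pselect (bad n (s, t))) => [|nb]; last by exists (s, t) => /nb.
  rewrite /bad/= => b.
  case: (pselect (exists c' : R * R, bad n.+1 c' /\ (s <= c'.1 <= s + w n.+1 /\
      t <= c'.2 <= t + v n.+1))) => [[c' [? [? ?]]]|nex]; first by exists c'.
  have nb c' : s <= c'.1 <= s + w n.+1 -> t <= c'.2 <= t + v n.+1 ->
      - k * (w n.+1 * v n.+1) <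
      rect_diff F c'.1 (c'.1 + w n.+1) c'.2 (c'.2 + v n.+1).
    move=> h1 h2; rewrite ltNge; apply/negP => h3; apply: nex.
    by exists c'.
  have n1 : s <= s <= s + w n.+1 by lra.
  have n2 : s <= s + w n.+1 <= s + w n.+1 by lra.
  have n3 : t <= t <= t + v n.+1 by lra.
  have n4 : t <= t + v n.+1 <= t + v n.+1 by lra.
  (* The corner sums of the four quarters add up to that of the whole, so they cannot all exceed a
     quarter of the bound. *)
  have := nb (s, t) n1 n3; have := nb (s, t + v n.+1) n1 n4.
  have := nb (s + w n.+1, t) n2 n3; have := nb (s + w n.+1, t + v n.+1) n2 n4.
  move: b; rewrite /rect_diff/= w2 v2 -!addrA -[w n.+1 + w n.+1]mulr2n
    -[v n.+1 + v n.+1]mulr2n -[w n.+1 *+ 2]mulr_natl -[v n.+1 *+ 2]mulr_natl.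
  move=> *; lra.
have [nx nxP] := choice step.
pose fix c n := if n is m.+1 then nx (m, c m) else (s0, t0).
have cbad n : bad n (c n).
  elim: n => [|n IH] /=; last by have [] := nxP (n, c n) IH.
  rewrite /bad /= /w /v expr0 !divr1 !subrKC /k /w /v expr0 !divr1 mulNr mulfVK ?opprK//.
  by rewrite mulf_neq0// subr_eq0 gt_eqF.
have cS n : ((c n).1 <= (c n.+1).1 /\ (c n.+1).1 + w n.+1 <= (c n).1 + w n) /\
            ((c n).2 <= (c n.+1).2 /\ (c n.+1).2 + v n.+1 <= (c n).2 + v n).
  have /= [_ /andP[? ?] /andP[? ?]] := nxP (n, c n) (cbad n).
  by rewrite (w2 n) (v2 n); split; split=> //; lra.
have cD n m : ((c n).1 <= (c (m + n)%N).1 /\ (c (m + n)%N).1 + w (m + n)%N <= (c n).1 + w n)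
   /\ ((c n).2 <= (c (m + n)%N).2 /\ (c (m + n)%N).2 + v (m + n)%N <= (c n).2 + v n).
  elim: m => [|m [[i1 i2] [i3 i4]]]; first by rewrite add0n.
  have [[j1 j2] [j3 j4]] := cS (m + n)%N; rewrite addSn.
  by split; split; [exact: le_trans j1|exact: le_trans i2
    |exact: le_trans j3|exact: le_trans i4].
(* Every lower-left corner lies below every upper-right corner, so the suprema of the lower-left
   corners lie in all the rectangles. *)
have cub m n : (c m).1 <= (c n).1 + w n /\ (c m).2 <= (c n).2 + v n.
  case/orP: (leq_total m n) => mn.
    have := cD m (n - m)%N; rewrite subnK// => -[[? ?] [? ?]].
    by split; rewrite -[leLHS]addr0 lerD// ltW.
  have := cD n (m - n)%N; rewrite subnK// => -[[? i1] [? i2]].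
  by split; [apply: le_trans i1|apply: le_trans i2]; rewrite lerDl ltW.
pose p1 := sup (range (fun n => (c n).1)); pose p2 := sup (range (fun n => (c n).2)).
have p1P n : (c n).1 <= p1 <= (c n).1 + w n.
  apply/andP; split.
    apply: ub_le_sup; last by exists n.
    by exists ((c n).1 + w n) => _ [m _ <-]; have [] := cub m n.
  by apply: ge_sup => [|_ [m _ <-]]; [exists (c 0%N).1, 0%N|have [] := cub m n].
have p2P n : (c n).2 <= p2 <= (c n).2 + v n.
  apply/andP; split.
    apply: ub_le_sup; last by exists n.
    by exists ((c n).2 + v n) => _ [m _ <-]; have [] := cub m n.
  by apply: ge_sup => [|_ [m _ <-]]; [exists (c 0%N).2, 0%N|have [] := cub m n].
have [||P [q [S [q0 pe]]]] := H p1 p2.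
- by have := p1P 0; rewrite /w expr0 divr1 /= subrKC.
- by have := p2P 0; rewrite /v expr0 divr1 /= subrKC.
pose W := w 0%N ^+ 2 + v 0%N ^+ 2.
have W0 : 0 < W by rewrite addr_gt0 ?exprn_gt0.
(* All rectangles are similar, so with this constant the error of the expansion is exactly
   [k * (w n * v n) / 2], half of what badness demands. *)
have e0 : 0 < k * (w 0%N * v 0%N) / (8 * W).
  by apply: divr_gt0; apply: mulr_gt0 => //; exact: mulr_gt0.
have [d d0 dP] := rect_diff_expansion pe e0.
have [n nd] : exists n, w n < d /\ v n < d.
  have ub : exists n, (w 0%N + v 0%N) / d < 2 ^+ n.
    exists (Num.bound ((w 0%N + v 0%N) / d)); apply: lt_le_trans.
      by apply: archi_boundP; rewrite ltW// divr_gt0// addr_gt0.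
    by rewrite -natrX ler_nat ltnW// ltn_expl.
  have [n] := ub; rewrite ltr_pdivrMr// => ltn; exists n.
  have p2n : 0 < 2 ^+ n :> R by rewrite exprn_gt0.
  have := w0 0; have := v0 0; move: ltn; rewrite /w /v expr0 !divr1 => ? ? ?.
  by split; rewrite ltr_pdivrMr//; lra.
have := dP _ _ _ _ (p1P n) (p2P n) nd.1 nd.2.
have := cbad n; rewrite /bad => b; rewrite ler_norml => /andP[+ _].
have wv : 0 < w n * v n by rewrite mulr_gt0.
have -> : 4 * (k * (w 0%N * v 0%N) / (8 * W)) * (w n ^+ 2 + v n ^+ 2) =
    k * (w n * v n) / 2.
  have wn : w n = w 0%N / 2 ^+ n by rewrite /w expr0 divr1.
  have vn : v n = v 0%N / 2 ^+ n by rewrite /v expr0 divr1.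
  rewrite wn vn /W; field.
  by rewrite expf_neq0// gt_eqF.
have : 0 <= q * w n * v n by rewrite -mulrA mulr_ge0// ltW.
have : 0 < k * (w n * v n) by rewrite mulr_gt0.
lra.
Qed.

(** * Row vectors of length two, dot products and the interior of the parallelogram *)

Lemma row2P (R : realType) (x y : 'rV[R]_2) :
  x 0 0 = y 0 0 -> x 0 1 = y 0 1 -> x = y.
Proof.
move=> e0 e1; apply/rowP => i.
by case: (unliftP 0 i) => [j ->|->//]; rewrite ord1;
  have -> : lift 0 0 = 1 :> 'I_2 by apply: val_inj.
Qed.

Lemma vec2E (R : realType) (s t : R) :
  vec2 s t = s *: delta_mx 0 0 + t *: delta_mx 0 1.
Proof. by apply: row2P; rewrite !mxE/= ?mulr1 ?mulr0 ?addr0 ?add0r. Qed.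

Lemma vec2_eta (R : realType) (x : 'rV[R]_2) : vec2 (x 0 0) (x 0 1) = x.
Proof. by apply: row2P; rewrite !mxE. Qed.

Lemma dotE (R : realType) (u v : 'rV[R]_2) :
  dot u v = u 0 0 * v 0 0 + u 0 1 * v 0 1.
Proof.
rewrite /dot !big_ord_recl big_ord0 addr0.
by have -> : lift ord0 ord0 = 1 :> 'I_2 by apply: val_inj.
Qed.

Lemma vec2_continuous (R : realType) :
  continuous (fun y : R * R => vec2 y.1 y.2).
Proof.
rewrite (_ : (fun y => _) = (fun y => y.1 *: delta_mx 0 0 + y.2 *: delta_mx 0 1)).
  2: by apply: funext => y; rewrite vec2E.
move=> y.
by apply: cvgD; apply: cvgZl; [exact: cvg_fst|exact: cvg_snd].
Qed.

Lemma nbhs_vec2 (R : realType) (u v : R) (P : set 'rV[R]_2) :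
  nbhs (vec2 u v) P -> exists2 d, 0 < d &
    forall x y, `|x - u| < d -> `|y - v| < d -> P (vec2 x y).
Proof.
move=> nP; have /nbhs_ballP[d /= d0 dP] := @vec2_continuous R (u, v) P nP.
exists d => // x y xu yv; apply: (dP (x, y)); split => /=;
  by rewrite -ball_normE /ball_/= distrC.
Qed.

(** The two difference quotients are the same function of [h]. *)
Lemma is_derive_vec2_fst (R : realType) (f : 'rV[R]_2 -> R) (u v l : R) :
  is_derive (vec2 u v) (delta_mx 0 0) f l ->
  is_derive u 1 (fun x => f (vec2 x v)) l.
Proof.
have E : (fun h : R => h^-1 *: (((fun x => f (vec2 x v)) \o shift u) (h *: 1)
       - f (vec2 u v))) =
    (fun h => h^-1 *: ((f \o shift (vec2 u v)) (h *: delta_mx 0 0) - f (vec2 u v))).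
  by apply: funext => h /=; rewrite !vec2E [h *: 1]mulr1 scalerDl addrA.
by move=> [df fE]; split; [rewrite /derivable E|rewrite /derive E].
Qed.

Lemma is_derive_vec2_snd (R : realType) (f : 'rV[R]_2 -> R) (u v l : R) :
  is_derive (vec2 u v) (delta_mx 0 1) f l ->
  is_derive v 1 (fun y => f (vec2 u y)) l.
Proof.
have E : (fun h : R => h^-1 *: (((fun y => f (vec2 u y)) \o shift v) (h *: 1)
       - f (vec2 u v))) =
    (fun h => h^-1 *: ((f \o shift (vec2 u v)) (h *: delta_mx 0 1) - f (vec2 u v))).
  by apply: funext => h /=; rewrite !vec2E [h *: 1]mulr1 scalerDl addrCA.
by move=> [df fE]; split; [rewrite /derivable E|rewrite /derive E].
Qed.

Lemma dot_continuous (R : realType) (a : 'rV[R]_2) : continuous (dot a).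
Proof.
pose p i (x : 'rV[R]_2) := x 0 i.
have -> : dot a = cst (a 0 0) * p 0 + cst (a 0 1) * p 1.
  by apply: funext => x; rewrite dotE.
by move=> x; apply: continuousD; apply: continuousM;
  first [exact: cst_continuous|exact: coord_continuous].
Qed.

Lemma parallelogram_interior (R : realType) (a b : 'rV[R]_2) (c1 d1 c2 d2 : R)
    (x : 'rV[R]_2) :
  c1 < dot a x < d1 -> c2 < dot b x < d2 -> (parallelogram a b c1 d1 c2 d2)° x.
Proof.
move=> xa xb.
have o : open (dot a @^-1` `]c1, d1[ `&` dot b @^-1` `]c2, d2[).
  by apply: openI; apply: open_comp => [y _|];
    [exact: dot_continuous|exact: interval_open|exact: dot_continuous|exact: interval_open].
move/interior_id: o => o; suff: (dot a @^-1` `]c1, d1[ `&` dot b @^-1` `]c2, d2[)° x.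
  apply: interiorS => y [/=].
  by rewrite !in_itv/= => /andP[? ?] /andP[? ?]; split; rewrite !ltW.
by rewrite o; split; rewrite /= in_itv.
Qed.

(** * Second-order expansion of [f] and linear changes of variables *)

(** Near an interior point, continuity within [Om] is ordinary continuity, so the second partials
    stay within [e / 2] of their values there; the factor 2 in [taylor_mixed] turns this into
    [e]. *)
Lemma peano_expansion_vec2 (R : realType) (Om : set 'rV[R]_2) (f f11 f12 f22 : 'rV[R]_2 -> R)
    (u v : R) :
  continuous_partial2 Om f 0 0 f11 -> continuous_partial2 Om f 0 1 f12 ->
  continuous_partial2 Om f 1 1 f22 -> Om° (vec2 u v) ->
  peano_expansion (fun x y => f (vec2 x y)) u v
    (f11 (vec2 u v) / 2) (f12 (vec2 u v)) (f22 (vec2 u v) / 2).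
Proof.
move=> [c11 h11] [c12 h12] [c22 h22] Op.
exists (f (vec2 u v)), ('D_(delta_mx 0 0) f (vec2 u v)),
  ('D_(delta_mx 0 1) f (vec2 u v)) => e e0.
have near_e (g : 'rV[R]_2 -> R) : {within Om, continuous g} ->
    \forall x \near vec2 u v, `|g x - g (vec2 u v)| <= e / 2.
  move=> /subspace_continuousP /(_ _ (interior_subset Op)).
  rewrite within_interior// => /cvgrPdist_le /(_ (e / 2)).
  move=> H; have {}H := H (divr_gt0 e0 (ltr0n _ 2)).
  by apply: filterS H => x; rewrite distrC.
have : nbhs (vec2 u v) (Om° `&` [set x | `|f11 x - f11 (vec2 u v)| <= e / 2] `&`
    [set x | `|f12 x - f12 (vec2 u v)| <= e / 2] `&`
    [set x | `|f22 x - f22 (vec2 u v)| <= e / 2]).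
  do 3!(apply: filterI; last exact: near_e).
  exact: nbhs_interior.
move=> /nbhs_vec2[d d0 dP]; exists d => // h k hd kd.
have -> : e = 2 * (e / 2) by field.
apply: (@taylor_mixed _ (fun x y => f (vec2 x y))
  (fun x y => 'D_(delta_mx 0 0) f (vec2 x y))
  (fun x y => 'D_(delta_mx 0 1) f (vec2 x y))
  (fun x y => f11 (vec2 x y)) (fun x y => f12 (vec2 x y))
  (fun x y => f22 (vec2 x y))) => x y xh yk.
have [[[Oxy ? ? ?]]] := dP x y (le_lt_trans xh hd) (le_lt_trans yk kd).
split=> //.
have [/derivableP ? ?] := h11 _ Oxy; have [_ ?] := h12 _ Oxy.
have [/derivableP ? ?] := h22 _ Oxy.
by split; [apply: is_derive_vec2_fst|apply: is_derive_vec2_snd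
  |apply: (is_derive_vec2_fst (f := 'D_(delta_mx 0 0) f))
  |apply: (is_derive_vec2_fst (f := 'D_(delta_mx 0 1) f))
  |apply: (is_derive_vec2_snd (f := 'D_(delta_mx 0 1) f))].
Qed.

(** The new coefficients are those of the quadratic form after substituting the two linear forms.
    Only the error term needs an estimate. *)
Lemma peano_expansion_linear (R : realType) (phi F : R -> R -> R)
    (u v s t l1 l2 m1 m2 P q S : R) :
  peano_expansion phi u v P q S ->
  (forall h k, F (s + h) (t + k) = phi (u + (l1 * h + l2 * k)) (v + (m1 * h + m2 * k))) ->
  peano_expansion F s t (P * l1 ^+ 2 + q * l1 * m1 + S * m1 ^+ 2)
    (2 * P * l1 * l2 + q * (l1 * m2 + l2 * m1) + 2 * S * m1 * m2)
    (P * l2 ^+ 2 + q * l2 * m2 + S * m2 ^+ 2).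
Proof.
move=> [A [B [C H]]] FE.
exists A, (B * l1 + C * m1), (B * l2 + C * m2) => e e0.
(* [N] bounds all four coefficients and the summand 1 makes it positive. Each linear form has square
   at most [2 * N ^+ 2 * (h ^+ 2 + k ^+ 2)], whence the divisor [4 * N ^+ 2]. *)
pose N := `|l1| + `|l2| + `|m1| + `|m2| + 1.
have N0 : 0 < N by rewrite ltr_wpDl// !addr_ge0.
have e1 : 0 < e / (4 * N ^+ 2) by rewrite divr_gt0// mulr_gt0// exprn_gt0.
have [d d0 {}H] := H _ e1.
exists (d / (2 * N)); first by rewrite divr_gt0// mulr_gt0.
move=> h k hd kd.
have b (x y : R) : `|x| <= N -> `|y| <= N -> `|x * h + y * k| <= N * (`|h| + `|k|).
  move=> xN yN; rewrite (le_trans (ler_normD _ _))// !normrM mulrDr.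
  by rewrite lerD// ler_wpM2r.
have b1 : `|l1 * h + l2 * k| <= N * (`|h| + `|k|).
  by apply: b; rewrite /N; have := normr_ge0 l1; have := normr_ge0 l2;
    have := normr_ge0 m1; have := normr_ge0 m2; lra.
have b2 : `|m1 * h + m2 * k| <= N * (`|h| + `|k|).
  by apply: b; rewrite /N; have := normr_ge0 l1; have := normr_ge0 l2;
    have := normr_ge0 m1; have := normr_ge0 m2; lra.
have bd : N * (`|h| + `|k|) < d.
  have -> : d = N * (d / (2 * N) + d / (2 * N)) by field; rewrite gt_eqF.
  by rewrite ltr_pM2l// ltrD.
have := H _ _ (le_lt_trans b1 bd) (le_lt_trans b2 bd); rewrite -FE => le1.
have sq (x : R) : `|x| <= N * (`|h| + `|k|) -> x ^+ 2 <= 2 * N ^+ 2 * (h ^+ 2 + k ^+ 2).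
  move=> xb; rewrite -(real_normK (num_real x)) -(real_normK (num_real h)).
  rewrite -(real_normK (num_real k)).
  apply: (@le_trans _ _ ((N * (`|h| + `|k|)) ^+ 2)).
    by rewrite lerXn2r// nnegrE// mulr_ge0 ?addr_ge0// ltW.
  rewrite exprMn [2 * N ^+ 2]mulrC -[N ^+ 2 * 2 * _]mulrA ler_pM2l ?exprn_gt0//.
  by have := sqr_ge0 (`|h| - `|k|); nra.
apply: (@le_trans _ _ (e / (4 * N ^+ 2) * ((l1 * h + l2 * k) ^+ 2 + (m1 * h + m2 * k) ^+ 2))).
  by apply: le_trans le1; rewrite le_eqVlt; apply/orP; left; apply/eqP; congr `|_|; ring.
apply: (@le_trans _ _ (e / (4 * N ^+ 2) * (4 * N ^+ 2 * (h ^+ 2 + k ^+ 2)))).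
  rewrite ler_wpM2l ?(ltW e1)//; have := sq _ b1; have := sq _ b2; lra.
by rewrite mulrA divfK// mulf_neq0// expf_neq0// gt_eqF.
Qed.

(** * Closed rectangles and the explicit approximant *)

(** Derivatives are controlled only in the interior. A rectangle touching the boundary is moved
    inwards by [r] on every side, and [r] tends to 0 from the right; degenerate rectangles have
    corner sum 0. *)
Lemma rect_diff_ge0_closure (R : realType) (G : R -> R -> R) (c1 d1 c2 d2 : R) :
  continuous (fun y : R * R => G y.1 y.2) ->
  (forall s s' t t', c1 < s -> s < s' -> s' < d1 -> c2 < t -> t < t' -> t' < d2 ->
     0 <= rect_diff G s s' t t') ->
  forall s s' t t', c1 <= s -> s <= s' -> s' <= d1 -> c2 <= t -> t <= t' -> t' <= d2 ->
     0 <= rect_diff G s s' t t'.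
Proof.
move=> cG H s s' t t' cs; rewrite le_eqVlt => /orP[/eqP<- *|ss' sd ct].
  by rewrite le_eqVlt; apply/orP; left; apply/eqP; rewrite /rect_diff; ring.
rewrite le_eqVlt => /orP[/eqP<- *|tt' td].
  by rewrite le_eqVlt; apply/orP; left; apply/eqP; rewrite /rect_diff; ring.
pose D (r : R) := rect_diff G (s + r) (s' - r) (t + r) (t' - r).
have -> : rect_diff G s s' t t' = D 0 by rewrite /D !addr0 !subr0.
have cD : D r @[r --> 0] --> D 0.
  have cG' (p1 p2 : R -> R) : continuous p1 -> continuous p2 ->
      G (p1 r) (p2 r) @[r --> (0 : R)] --> G (p1 0) (p2 0).
    move=> cp1 cp2.
    exact: (cvg_comp2 (cp1 0) (cp2 0) (cG (p1 0, p2 0))).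
  have cp x : continuous (fun r : R => x + r).
    by move=> r; apply: cvgD; [exact: cvg_cst|exact: cvg_id].
  have cm x : continuous (fun r : R => x - r).
    by move=> r; apply: cvgB; [exact: cvg_cst|exact: cvg_id].
  by apply: cvgB; [apply: cvgB; [apply: cvgD|]|];
    apply: (cG' (fun r => _) (fun r => _)).
apply: (cvgr_to_ge (cvg_at_right_filter cD)).
(* Below this bound the shrunken rectangle is still nondegenerate. *)
have m0 : 0 < Num.min ((s' - s) / 2) ((t' - t) / 2).
  by rewrite lt_min !divr_gt0// subr_gt0.
near=> r.
have r0 : 0 < r by near: r; exact: nbhs_right_gt.
have : r < Num.min ((s' - s) / 2) ((t' - t) / 2).
  by near: r; exact: nbhs_right_lt.
rewrite lt_min => /andP[? ?].
by apply: H; lra.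
Unshelve. all: by end_near. Qed.

Lemma continuous_comp_within (T U V : topologicalType) (A : set U) (g : T -> U)
    (f : U -> V) :
  continuous g -> (forall y, A (g y)) -> {within A, continuous f} ->
  continuous (f \o g).
Proof.
move=> cg gA /subspace_continuousP cf y; apply: cvg_comp (cf _ (gA y)).
by move=> P /cg; apply: (@filterS _ (nbhs y)) => z /=; apply; exact: gA.
Qed.

(** If the determinant vanishes, dividing by a nonzero coordinate of [b] exhibits [a] as a multiple
    of [b]. *)
Lemma free2_det (R : realType) (a b : 'rV[R]_2) :
  free [:: a; b] -> a 0 0 * b 0 1 - a 0 1 * b 0 0 != 0.
Proof.
rewrite free_cons seq1_free span_seq1 => /andP[ab b0].
apply: contra ab => /eqP D0; apply/vlineP.
have [b00|b00] := eqVneq (b 0 0) 0; last first.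
  exists (a 0 0 / b 0 0); apply: row2P; rewrite !mxE ?divfK//.
  apply: (mulIf b00); rewrite mulrAC divfK//.
  by apply/eqP; rewrite eq_sym -subr_eq0 D0.
have b01 : b 0 1 != 0.
  by apply: contra b0 => /eqP b01; apply/eqP/row2P; rewrite mxE.
exists (a 0 1 / b 0 1); apply: row2P; rewrite !mxE ?divfK//.
apply: (mulIf b01); rewrite mulrAC divfK//.
by apply/eqP; rewrite -subr_eq0 D0.
Qed.

(** Of the four pieces cut out by the point, the lower-left and upper-right corner sums enter four
    times the error with sign plus, the other two with sign minus. *)
Lemma ridge_approximation (R : realType) (G : R -> R -> R) (c1 d1 c2 d2 x y : R) :
  (forall s s' t t', c1 <= s -> s <= s' -> s' <= d1 -> c2 <= t -> t <= t' -> t' <= d2 ->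
     0 <= rect_diff G s s' t t') ->
  c1 <= x <= d1 -> c2 <= y <= d2 ->
  `|G x y - ((G x c2 + G x d2) / 2 + ((G c1 y + G d1 y) / 2
     - (G c1 c2 + G c1 d2 + G d1 c2 + G d1 d2) / 4))| <= rect_diff G c1 d1 c2 d2 / 4.
Proof.
move=> H /andP[cx xd] /andP[cy yd].
have := H c1 x c2 y (lexx _) cx xd (lexx _) cy yd.
have := H x d1 c2 y cx xd (lexx _) (lexx _) cy yd.
have := H c1 x y d2 (lexx _) cx xd cy yd (lexx _).
have := H x d1 y d2 cx xd (lexx _) cy yd (lexx _).
by rewrite /rect_diff ler_norml => *; lra.
Qed.

(** * Clamping and the coordinates [a.x], [b.x] *)

(** Projection onto [[c, d]]. It extends [f] continuously beyond the rectangle, since ridge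
    functions must be continuous on the whole line. *)
Definition clamp (R : realType) (c d x : R) : R := Num.max c (Num.min d x).

Lemma clamp_continuous (R : realType) (c d : R) : continuous (clamp c d).
Proof.
move=> x; apply: (@continuous_max _ _ (fun=> c) (fun x => Num.min d x)).
  exact: cst_continuous.
apply: (@continuous_min _ _ (fun=> d) id); first exact: cst_continuous.
exact: cvg_id.
Qed.

Lemma clamp_itv (R : realType) (c d x : R) : c <= d -> c <= clamp c d x <= d.
Proof. by move=> cd; rewrite /clamp le_max lexx/= ge_max cd ge_min lexx. Qed.

Lemma clamp_id (R : realType) (c d x : R) : c <= x <= d -> clamp c d x = x.
Proof. by move=> /andP[cx xd]; rewrite /clamp min_r// max_r. Qed.

(** Cramer's rule: the inverse of [x] going to [(dot a x, dot b x)]. By conversion [f_coord a b f]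
    is [f] composed with it. *)
Definition of_coord (R : realType) (a b : 'rV[R]_2) (y1 y2 : R) : 'rV[R]_2 :=
  let D := a 0 0 * b 0 1 - a 0 1 * b 0 0 in
  vec2 ((y1 * b 0 1 - y2 * a 0 1) / D) ((y2 * a 0 0 - y1 * b 0 0) / D).

Section Coordinates.
Variables (R : realType) (a b : 'rV[R]_2).
Hypothesis det_neq0 : a 0 0 * b 0 1 - a 0 1 * b 0 0 != 0.

Lemma dot_of_coordl (y1 y2 : R) : dot a (of_coord a b y1 y2) = y1.
Proof. by rewrite dotE !mxE/=; field. Qed.

Lemma dot_of_coordr (y1 y2 : R) : dot b (of_coord a b y1 y2) = y2.
Proof. by rewrite dotE !mxE/=; field. Qed.

Lemma of_coord_dot (x : 'rV[R]_2) : of_coord a b (dot a x) (dot b x) = x.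
Proof. by rewrite -[RHS]vec2_eta /of_coord !dotE/=; congr vec2; field. Qed.

Lemma of_coord_continuous : continuous (fun y : R * R => of_coord a b y.1 y.2).
Proof.
set D := a 0 0 * b 0 1 - a 0 1 * b 0 0.
have lin (p q : R) : continuous (fun y : R * R => (y.1 * p - y.2 * q) / D).
  move=> y; apply: cvgMr_tmp; apply: cvgB; apply: cvgMr_tmp; [exact: cvg_fst|exact: cvg_snd].
have lin' (p q : R) : continuous (fun y : R * R => (y.2 * p - y.1 * q) / D).
  move=> y; apply: cvgMr_tmp; apply: cvgB; apply: cvgMr_tmp; [exact: cvg_snd|exact: cvg_fst].
move=> y; exact: (cvg_comp2 (@lin (b 0 1) (a 0 1) y) (@lin' (a 0 0) (b 0 0) y)
  (@vec2_continuous R (_, _))).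
Qed.

(** The mixed coefficient is the differential expression of the hypothesis divided by the squared
    determinant, so the sign carries over for either orientation of [a] and [b]. *)
Lemma peano_expansion_of_coord (Om : set 'rV[R]_2) (f f11 f12 f22 : 'rV[R]_2 -> R)
    (y1 y2 : R) :
  continuous_partial2 Om f 0 0 f11 -> continuous_partial2 Om f 0 1 f12 ->
  continuous_partial2 Om f 1 1 f22 -> Om° (of_coord a b y1 y2) ->
  let x := of_coord a b y1 y2 in
  exists P S, peano_expansion (f_coord a b f) y1 y2 P
    ((f12 x * (a 0 0 * b 0 1 + a 0 1 * b 0 0)
      - f11 x * (a 0 1 * b 0 1) - f22 x * (a 0 0 * b 0 0))
      / (a 0 0 * b 0 1 - a 0 1 * b 0 0) ^+ 2) S.
Proof.
move=> h11 h12 h22 Ox x; rewrite -/x.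
set D := a 0 0 * b 0 1 - a 0 1 * b 0 0.
have := peano_expansion_vec2 h11 h12 h22 Ox; rewrite -/(of_coord a b y1 y2) -/x => pe.
have FE h k : f_coord a b f (y1 + h) (y2 + k) =
    f (vec2 ((y1 * b 0 1 - y2 * a 0 1) / D + (b 0 1 / D * h + - a 0 1 / D * k))
            ((y2 * a 0 0 - y1 * b 0 0) / D + (- b 0 0 / D * h + a 0 0 / D * k))).
  by rewrite /f_coord -/D; congr (f (vec2 _ _)); rewrite /D; field.
have := peano_expansion_linear pe FE.
set P := (X in peano_expansion _ _ _ X _ _); set q := (X in peano_expansion _ _ _ _ X _).
set S := (X in peano_expansion _ _ _ _ _ X) => E; exists P, S.
suff <- : q = (f12 x * (a 0 0 * b 0 1 + a 0 1 * b 0 0)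
      - f11 x * (a 0 1 * b 0 1) - f22 x * (a 0 0 * b 0 0)) / D ^+ 2 by [].
by rewrite /q /D; field.
Qed.

(** [G] is [f] in the new coordinates with clamped arguments: globally continuous, and with
    nonnegative corner sums inside the closed rectangle. *)
Lemma supermodular_extension (c1 d1 c2 d2 : R) (f f11 f12 f22 : 'rV[R]_2 -> R)
    (Om := parallelogram a b c1 d1 c2 d2) :
  c1 < d1 -> c2 < d2 -> {within Om, continuous f} ->
  continuous_partial2 Om f 0 0 f11 -> continuous_partial2 Om f 0 1 f12 ->
  continuous_partial2 Om f 1 1 f22 ->
  (forall x, Om x -> 0 <= f12 x * (a 0 0 * b 0 1 + a 0 1 * b 0 0)
            - f11 x * (a 0 1 * b 0 1) - f22 x * (a 0 0 * b 0 0)) ->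
  exists G : R -> R -> R, [/\ continuous (fun y : R * R => G y.1 y.2),
    forall x y, c1 <= x <= d1 -> c2 <= y <= d2 -> G x y = f_coord a b f x y &
    forall s s' t t', c1 <= s -> s <= s' -> s' <= d1 -> c2 <= t -> t <= t' -> t' <= d2 ->
      0 <= rect_diff G s s' t t'].
Proof.
move=> cd1 cd2 hf h11 h12 h22 h0.
pose G x y := f_coord a b f (clamp c1 d1 x) (clamp c2 d2 y).
have GE x y : c1 <= x <= d1 -> c2 <= y <= d2 -> G x y = f_coord a b f x y.
  by move=> ? ?; rewrite /G !clamp_id.
have cG : continuous (fun y : R * R => G y.1 y.2).
  apply: (@continuous_comp_within _ _ _ Om
    (fun y : R * R => of_coord a b (clamp c1 d1 y.1) (clamp c2 d2 y.2)) f) => //.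
    move=> y.
    have k1 : clamp c1 d1 z.1 @[z --> y] --> clamp c1 d1 y.1.
      apply: (cvg_comp _ _ cvg_fst); exact: clamp_continuous.
    have k2 : clamp c2 d2 z.2 @[z --> y] --> clamp c2 d2 y.2.
      apply: (cvg_comp _ _ cvg_snd); exact: clamp_continuous.
    exact: (cvg_comp2 k1 k2 (@of_coord_continuous (_, _))).
  by move=> y; split; rewrite ?dot_of_coordl ?dot_of_coordr clamp_itv// ltW.
exists G; split=> //; apply: rect_diff_ge0_closure => // s s' t t' cs ss' sd ct tt' td.
have -> : rect_diff G s s' t t' = rect_diff (f_coord a b f) s s' t t'.
  by rewrite /rect_diff !GE//; apply/andP; split; lra.
apply: rect_diff_ge0 => // x y /andP[sx xs] /andP[ty yt].
have Ox : Om° (of_coord a b x y).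
  by apply: parallelogram_interior; rewrite ?dot_of_coordl ?dot_of_coordr;
    apply/andP; split; lra.
have [P [S pe]] := peano_expansion_of_coord h11 h12 h22 Ox.
exists P; eexists; exists S; split; last exact: pe.
by rewrite divr_ge0 ?sqr_ge0// h0//; exact: interior_subset.
Qed.

End Coordinates.

(** * The error of approximation: upper and lower bound *)

Theorem theorem1p5 (R : realType) (a b : 'rV[R]_2) (c1 d1 c2 d2 : R)
    (f f11 f12 f22 : 'rV[R]_2 -> R)
    (hab : free [:: a; b]) (hcd1 : c1 < d1) (hcd2 : c2 < d2)
    (hf : {within parallelogram a b c1 d1 c2 d2, continuous f})
    (hf11 : continuous_partial2 (parallelogram a b c1 d1 c2 d2) f 0 0 f11)
    (hf12 : continuous_partial2 (parallelogram a b c1 d1 c2 d2) f 0 1 f12)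
    (hf22 : continuous_partial2 (parallelogram a b c1 d1 c2 d2) f 1 1 f22)
    (hge0 : forall x, parallelogram a b c1 d1 c2 d2 x ->
       0 <= f12 x * (a 0 0 * b 0 1 + a 0 1 * b 0 0)
            - f11 x * (a 0 1 * b 0 1) - f22 x * (a 0 0 * b 0 0)) :
  approx_error (parallelogram a b c1 d1 c2 d2) f (ridge_sums a b) =
  (4^-1 * (f_coord a b f c1 c2 + f_coord a b f d1 d2
           - f_coord a b f c1 d2 - f_coord a b f d1 c2))%:E.
Proof.
have D0 := free2_det hab.
have [G [cG GE Gge0]] := supermodular_extension D0 hcd1 hcd2 hf hf11 hf12 hf22 hge0.
have [c1i d1i] : c1 <= c1 <= d1 /\ c1 <= d1 <= d1 by rewrite !lexx ltW.
have [c2i d2i] : c2 <= c2 <= d2 /\ c2 <= d2 <= d2 by rewrite !lexx ltW.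
apply/eqP; rewrite eq_le; apply/andP; split.
  (* Upper bound: the averages over opposite sides, with the mean of the corner values absorbed into
     [g2]. *)
  pose g1 x := (G x c2 + G x d2) / 2.
  pose g2 y := (G c1 y + G d1 y) / 2 - (G c1 c2 + G c1 d2 + G d1 c2 + G d1 d2) / 4.
  have Gl y : continuous (G^~ y).
    by move=> x; exact: (cvg_comp2 cvg_id (cvg_cst y) (cG (x, y))).
  have Gr x : continuous (G x).
    by move=> y; exact: (cvg_comp2 (cvg_cst x) cvg_id (cG (x, y))).
  apply: ge_ereal_inf.
  exists (ereal_sup [set (`|f x - (g1 (dot a x) + g2 (dot b x))|)%:E |
      x in parallelogram a b c1 d1 c2 d2]).
    exists (fun x => g1 (dot a x) + g2 (dot b x)) => //; exists g1, g2; split=> //.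
    - by move=> x; apply: cvgMr_tmp; apply: cvgD; exact: Gl.
    - move=> y; apply: cvgB; last exact: cvg_cst.
      by apply: cvgMr_tmp; apply: cvgD; exact: Gr.
  apply: ge_ereal_sup => _ [x [xa xb] <-]; rewrite lee_fin.
  have -> : f x = G (dot a x) (dot b x) by rewrite GE// -{1}[x](of_coord_dot D0).
  apply: le_trans (ridge_approximation Gge0 xa xb) _.
  by rewrite /rect_diff !GE//; lra.
(* Lower bound: an arbitrary ridge sum is tested at the four corners. *)
apply: le_ereal_inf_tmp => _ [_ [g1 [g2 [_ _ ->]]] <-].
set M := ereal_sup _.
have MP y1 y2 : c1 <= y1 <= d1 -> c2 <= y2 <= d2 ->
    ((`|f_coord a b f y1 y2 - (g1 y1 + g2 y2)|)%:E <= M)%E.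
  move=> i1 i2; apply: ereal_sup_ubound; exists (of_coord a b y1 y2).
    by split; rewrite ?dot_of_coordl ?dot_of_coordr.
  by rewrite dot_of_coordl// dot_of_coordr.
(* An infinite supremum is harmless: plus infinity satisfies the bound, and minus infinity cannot
   dominate the value at a corner. *)
case: M MP => [m|_|MP]; last 2 first.
- by rewrite leey.
- by have := MP _ _ c1i c2i; rewrite leeNy_eq.
move=> MP; rewrite lee_fin.
(* In the alternating sum of the four bounds [g1] and [g2] cancel, leaving the corner sum of [f] at
   most [4 * m]. *)
have := MP _ _ c1i c2i; have := MP _ _ c1i d2i; have := MP _ _ d1i c2i.
have := MP _ _ d1i d2i; rewrite !lee_fin !ler_norml.
move=> /andP[? ?] /andP[? ?] /andP[? ?] /andP[? ?]; lra.
Qed.
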